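(* Let $m\ge2$, let $M\in GL(m,\mathbb{Z})$ and let $T=T_M:\mathbb{T}^m\to\mathbb{T}^m$ be the corresponding automorphism, which we assume to be generalized Pisot. Then for any $\epsilon>0$ there exists an open connected hole $H\subset\mathbb{T}^m$ such that $\mathcal{H}_m(H)>1-\epsilon$ and $\dim_H(\mathcal{J}(H))>0$.
   Context: $\mathbb{T}^m=\mathbb{R}^m/\mathbb{Z}^m$, $\mathcal{H}_m$ is the (normalized) Haar measure on $\mathbb{T}^m$, and $\dim_H$ is Hausdorff dimension. For $M\in GL(m,\mathbb{Z})$ (an $m\times m$ integer matrix with determinant $\pm1$), $T_M x=Mx\bmod\mathbb{Z}^m$. $T_M$ is a Pisot automorphism if the characteristic polynomial of $M$ is irreducible over $\mathbb{Q}$, has one real root $\beta>1$, and all its other roots have modulus less than $1$. An automorphism $T$ is generalized Pisot if one of $T,-T,T^{-1},-T^{-1}$ is Pisot. A hole is an open subset $H$ of $\mathbb{T}^m$, and its survivor set $\mathcal{J}(H)$ is the set of all $x\in\mathbb{T}^m$ whose $T$-orbit $\{T^n x:n\in\mathbb{Z}\}$ does not intersect $H$. *)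

(* Defs.v *)
From HB Require Import structures.
From mathcomp Require Import all_boot all_order all_algebra.
From mathcomp Require Import generic_quotient ring_quotient complex.
From mathcomp Require Import all_classical all_reals all_analysis.
From mathcomp Require Import measurable_realfun lra.

Set Implicit Arguments.
Unset Strict Implicit.
Unset Printing Implicit Defensive.

Import Order.TTheory GRing.Theory Num.Theory numFieldNormedType.Exports.

Local Open Scope classical_set_scope.
Local Open Scope ring_scope.
Local Open Scope quotient_scope.

Section torus.
Context (R : realType) (m : nat).

Definition lattice : {pred 'cV[R]_m} :=
  [pred x : 'cV[R]_m | x \is a mxOver (@Num.int R)].

Fact lattice_zmod_closed : zmod_closed lattice.
Proof.
split=> [|x y]; first by apply/mxOverP => i j; rewrite mxE rpred0.
move=> /mxOverP xZ /mxOverP yZ; apply/mxOverP => i j.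
by rewrite !mxE rpredB.
Qed.

HB.instance Definition _ :=
  GRing.isZmodClosed.Build 'cV[R]_m lattice lattice_zmod_closed.

Definition torus : Type := quotient_topology (Quotient.quot lattice).

HB.instance Definition _ := Topological.on torus.
HB.instance Definition _ := Quotient.on torus.
HB.instance Definition _ := GRing.isZmodule.Build torus
  (@Quotient.addqA _ lattice) (@Quotient.addqC _ lattice)
  (@Quotient.add0q _ lattice) (@Quotient.addNq _ lattice).
HB.instance Definition _ := isPointed.Build torus 0.

Definition toT (x : 'cV[R]_m) : torus := \pi_torus x.

Lemma toT_eq x y : (toT x == toT y) = (x - y \in lattice).
Proof.
rewrite (@Quotient.idealrBE _ lattice x y).
by apply/idP/idP => /eqP xy; apply/eqP.
Qed.

Lemma toTD x y : toT (x + y) = toT x + toT y.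
Proof. exact: (@Quotient.pi_add _ lattice). Qed.

Lemma toTB x y : toT (x - y) = toT x - toT y.
Proof. by apply/eqP; rewrite eq_sym subr_eq -toTD subrK. Qed.

Lemma toT_repr a : toT (repr a) = a. Proof. exact: reprK. Qed.

Lemma open_torusE (U : set torus) : open U = open (toT @^-1` U).
Proof. by []. Qed.

End torus.

Section toral_automorphisms.
Context (R : realType) (m : nat).
Implicit Types (M : 'M[int]_m) (a : torus R m).

Definition toral_map M a : torus R m := toT (map_mx intr M *m repr a).

Lemma toral_map_toT M (x : 'cV[R]_m) :
  toral_map M (toT x) = toT (map_mx intr M *m x).
Proof.
apply/eqP; rewrite toT_eq -mulmxBr.
have /eqP := toT_repr (toT x); rewrite toT_eq => /mxOverP hx.
apply/mxOverP => i j; rewrite mxE rpred_sum// => k _.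
by rewrite rpredM// mxE intr_int.
Qed.

Lemma toral_map1 : toral_map 1%:M =1 id.
Proof.
by move=> a; rewrite /toral_map map_mx1 mul1mx toT_repr.
Qed.

Lemma toral_mapM M N a : toral_map (M *m N) a = toral_map M (toral_map N a).
Proof.
by rewrite -[a]toT_repr !toral_map_toT map_mxM mulmxA.
Qed.

(* T_M^n for an integer n. Meaningful when [M \in unitmx], i.e. M is in GL(m, Z). *)
Definition toral_iter M (n : int) a : torus R m :=
  match n with
  | Posz k => iter k (toral_map M) a
  | Negz k => iter k.+1 (toral_map (invmx M)) a
  end.

Definition orbit_of M a : set (torus R m) := [set toral_iter M n a | n in setT].

Definition survivor M (H : set (torus R m)) : set (torus R m) :=
  [set a | orbit_of M a `&` H = set0].

End toral_automorphisms.

(* The complex roots of [char_poly M] are taken in [R[i]]; [`|z|] is the modulus of [z],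
   itself an element of [R[i]]. *)
Definition pisot (R : realType) m (M : 'M[int]_m) : Prop :=
  irreducible_poly (map_poly intr (char_poly M) : {poly rat}) /\
  exists beta : R,
    [/\ 1 < beta,
        root (map_poly intr (char_poly M)) beta
      & forall z : R[i], root (map_poly intr (char_poly M)) z ->
          z != (beta%:C)%C -> `|z| < 1].

Definition generalized_pisot (R : realType) m (M : 'M[int]_m) : Prop :=
  [\/ pisot R M, pisot R (- M), pisot R (invmx M) | pisot R (- invmx M)].

Section hausdorff_dimension.
Context (R : realType) (T : Type) (dist : T -> T -> R).
Local Open Scope ereal_scope.

(* [diam set0 = -oo], and [-oo `^ s = 0] for [s != 0]. *)
Definition diam (U : set T) : \bar R :=
  ereal_sup [set (dist p.1 p.2)%:E | p in U `*` U].

Definition hausdorff_premeasure (s delta : R) (A : set T) : \bar R :=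
  ereal_inf [set \sum_(0 <= i <oo) diam (U i) `^ s |
    U in [set U : (set T)^nat |
      (forall i, diam (U i) <= delta%:E) /\ A `<=` \bigcup_i U i]].

Definition hausdorff_measure (s : R) (A : set T) : \bar R :=
  ereal_sup [set hausdorff_premeasure s delta A | delta in [set d : R | (0 < d)%R]].

(* Restricting to [s > 0] avoids the convention for 0^0 in the 0-dimensional
   measure, and does not affect the infimum. *)
Definition hausdorff_dim (A : set T) : \bar R :=
  ereal_inf [set s%:E | s in [set s : R | (0 < s)%R /\ hausdorff_measure s A = 0]].

End hausdorff_dimension.

Section torus_distance.
Context (R : realType) (m : nat).

Definition enorm (x : 'cV[R]_m) : R := Num.sqrt (\sum_i x i ord0 ^+ 2).

(* The flat metric, i.e. the quotient of the Euclidean metric of R^m. *)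
Definition tdist (a b : torus R m) : R :=
  inf [set enorm (p.1 - p.2) | p in [set p | toT p.1 = a /\ toT p.2 = b]].

End torus_distance.

Section cube.
Context (R : realType).

Local Notation mR := (measurableTypeR R).

Definition cons_pair n (p : mR * n.-tuple mR) : n.+1.-tuple mR := [tuple of p.1 :: p.2].

Lemma measurable_cons_pair n : measurable_fun setT (@cons_pair n).
Proof. exact: (measurable_cons measurable_fst measurable_snd). Qed.

HB.instance Definition _ n :=
  isMeasurableFun.Build _ _ _ _ (@cons_pair n) (@measurable_cons_pair n).

(* The n-fold product of Lebesgue measure on [0, 1]. *)
Fixpoint cube_prob n : probability (n.-tuple mR) R :=
  match n with
  | 0 => \d_ [tuple]
  | n'.+1 => distribution (uniform_prob (@ltr01 R) \x cube_prob n')%E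
               (@cons_pair n')
  end.

Definition tuple_col n (x : n.-tuple mR) : 'cV[R]_n := \col_i tnth x i.

Lemma measurable_open_tuple_col n (U : set 'cV[R]_n) :
  open U -> measurable (@tuple_col n @^-1` U).
Proof.
move=> oU.
pose box (p : n.-tuple rat * rat) := [set x : n.-tuple mR | forall i : 'I_n,
  ratr (tnth p.1 i) - ratr p.2 < tnth x i < ratr (tnth p.1 i) + ratr p.2].
have mbox p : measurable (box p).
  have -> : box p = \bigcap_(i in [set: 'I_n]) ((@tnth n mR)^~ i @^-1`
      `]ratr (tnth p.1 i) - ratr p.2, ratr (tnth p.1 i) + ratr p.2[).
    apply/seteqP; split=> x /= h i; first by move=> _; rewrite /= in_itv/=.
    by have := h i I; rewrite /= in_itv.
  apply: (@fin_bigcap_measurable _ (n.-tuple mR) 'I_n setT) => [|i _].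
    exact: finite_finset.
  rewrite -[X in measurable X]setTI.
  exact: measurable_tnth.
have -> : @tuple_col n @^-1` U = \bigcup_p
   (if `[< box p `<=` @tuple_col n @^-1` U >] then box p else set0).
  apply/seteqP; split=> x /=; last first.
    by move=> [p _]; case: asboolP => // h; exact: h.
  move=> Ux; have := open_nbhs_nbhs (conj oU Ux).
  move=> /nbhs_ballP[e /= e0] eU.
  have e20 : 0 < e / 2 by exact: divr_gt0.
  have rexists : exists r : rat, 0 < (ratr r : R) < e / 2.
    by have [r] := rat_in_itvoo e20; rewrite in_itv/=; exists r.
  case: rexists => r /andP[r0 re].
  have /choice[q hq] : forall i : 'I_n, exists q : rat,
      tnth x i - ratr r < ratr q < tnth x i + ratr r.
    move=> i; have : tnth x i - ratr r < tnth x i + ratr r.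
      by rewrite ltrBlDr -addrA ltrDl addr_gt0.
    by move=> /rat_in_itvoo[q]; rewrite in_itv/=; exists q.
  exists ([tuple q i | i < n], r) => //.
  case: asboolP => [_ i /=|]; first rewrite tnth_mktuple.
    have /andP[h1 h2] := hq i.
    by apply/andP; split; [rewrite ltrBlDr|rewrite -ltrBlDr].
  case=> y hy; apply: eU; split => // i j.
  rewrite !mxE /ball/=; have := hy i; rewrite /= tnth_mktuple => /andP[h1 h2].
  have /andP[h3 h4] := hq i.
  rewrite ltr_norml; apply/andP; split; rewrite (splitr e); lra.
apply: countable_bigcupT_measurable => [|p]; first exact: countableP.
by case: asboolP.
Qed.


Definition frac (x : R) : R := x - (Num.floor x)%:~R.

Lemma frac_itv x : 0 <= frac x < 1.
Proof.
have /andP[h1 h2] := floor_itv x.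
by rewrite subr_ge0 h1/= ltrBlDl -[X in _ + X]/(1%:~R) -intrD.
Qed.

Lemma frac_unique x (k : int) : 0 <= x - k%:~R < 1 -> frac x = x - k%:~R.
Proof.
move=> /andP[h1 h2]; rewrite /frac (@floor_def _ x k)//.
by rewrite -subr_ge0 h1/= intrD -ltrBlDl.
Qed.

Lemma frac_fracD x y : frac (x + frac y) = frac (x + y).
Proof.
have e : x + frac y - (Num.floor (x + y) - Num.floor y)%:~R = frac (x + y).
  by rewrite intrB /frac; lra.
by rewrite -e; apply: frac_unique; rewrite e frac_itv.
Qed.

Lemma measurable_frac : measurable_fun setT (frac : mR -> mR).
Proof.
move=> _ A mA; rewrite setTI.
have -> : frac @^-1` A = \bigcup_(k : int)
    (`[k%:~R, (k + 1)%:~R[ `&` (fun x : mR => x - k%:~R) @^-1` A).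
  apply/seteqP; split=> x /=.
    by move=> Ax; exists (Num.floor x) => //; split => //; rewrite /= in_itv/= floor_itv.
  move=> [k _ [/=]]; rewrite in_itv/= => /floor_def kx.
  by rewrite /frac kx.
apply: countable_bigcupT_measurable => [|k]; first exact: countableP.
apply: measurableI => //.
rewrite -[X in measurable X]setTI.
exact: measurable_funD.
Qed.

Local Notation leb := (@lebesgue_measure R).

Lemma measurable_addr (t : R) : measurable_fun [set: mR] (fun x : mR => x + t : mR).
Proof. exact: measurable_funD. Qed.

Lemma lebesgue_shift (t : R) (A : set mR) : measurable A ->
  leb ((fun x => x + t) @^-1` A) = leb A.
Proof.
move=> mA; apply/esym.
apply: (@lebesgue_measure_unique R
  (pushforward leb (fun x : mR => x + t : mR))) => //.
  exact: measurable_addr.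
move=> _ _ [[a b] _ <-] /=.
rewrite /pushforward (_ : _ @^-1` _ = `]a - t, b - t]%classic); last first.
  by apply/seteqP; split => x /=; rewrite !in_itv/= ltrBlDr lerBrDr.
rewrite !lebesgue_measure_itv/= !lte_fin ltrD2r -!EFinD.
by case: ifP => // _; congr _%:E; lra.
Qed.

Lemma uniform_probE (A : set mR) : measurable A ->
  uniform_prob (@ltr01 R) A = leb (A `&` `[0, 1[).
Proof.
move=> mA; rewrite /uniform_prob integral_uniform_pdf.
rewrite (eq_integral (cst 1%E)); last first.
  move=> x; rewrite inE => -[_ /=]; rewrite in_itv/= /uniform_pdf => ->.
  by rewrite subr0 invr1.
rewrite integral_cst; last exact: measurableI.
rewrite mul1e.
have -> : A `&` `[0, 1] = (A `&` `[0, 1[) `|` (A `&` [set (1 : R)]).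
  apply/seteqP; split=> x /=; rewrite !in_itv/=.
    move=> [Ax /andP[x0]]; rewrite le_eqVlt => /predU1P[x1|x1]; first by right.
    by left; split => //; apply/andP.
  move=> [[Ax /andP[-> /ltW ->]]//|[Ax x1]].
  by rewrite x1 in Ax *; rewrite ler01 lexx.
rewrite measureU0//; [exact: measurableI|exact: measurableI|].
have m1 : measurable ([set 1] : set mR) by exact: measurable_set1.
apply/eqP; rewrite eq_le measure_ge0 andbT -(lebesgue_measure_set1 (1 : R)).
by apply: le_measure; rewrite ?inE//; exact: measurableI.
Qed.

Lemma uniform_frac (t : R) (A : set mR) : measurable A ->
  uniform_prob (@ltr01 R) ((fun x => frac (x + t)) @^-1` A) =
  uniform_prob (@ltr01 R) A.
Proof.
move=> mA; have /andP[] := frac_itv t.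
have -> : (fun x => frac (x + t)) = (fun x => frac (x + frac t)).
  by apply/funext => x; rewrite frac_fracD.
move: (frac t) => {}t t0 t1.
have mfA : measurable ((fun x => frac (x + t)) @^-1` A : set mR).
  rewrite -[X in measurable X]setTI.
  exact: (measurableT_comp measurable_frac (measurable_addr t)).
rewrite !uniform_probE//.
have mt1 : measurable (A `&` `[t, 1[ : set mR) by exact: measurableI.
have m0t : measurable (A `&` `[0, t[ : set mR) by exact: measurableI.
have mpre (s : R) (B : set mR) : measurable B ->
    measurable ((fun x => x + s) @^-1` B : set mR).
  by move=> mB; rewrite -[X in measurable X]setTI; exact: measurable_addr.
transitivity (leb (A `&` `[t, 1%R[) + leb (A `&` `[0%R, t[))%E.
  rewrite -(lebesgue_shift t mt1) -(lebesgue_shift (t - 1) m0t).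
  rewrite -measureU//; [|exact: mpre|exact: mpre|]; last first.
    apply/seteqP; split=> x //= -[[_]]; rewrite !in_itv/= => h1 [_ h2].
    lra.
  congr (leb _); apply/seteqP; split=> x /=; rewrite !in_itv/=.
    move=> [+ /andP[x0 x1]].
    have [xt|xt] := ltP (x + t) 1.
      by rewrite (@frac_unique _ 0) ?subr0 => [Ax|]; [left; split => //|]; lra.
    rewrite (@frac_unique _ 1) => [Ax|]; last lra.
    by right; rewrite addrA; split => //; lra.
  move=> [[Ax h]|[Ax h]].
    by rewrite (@frac_unique _ 0) ?subr0; [split => //|]; lra.
  by rewrite (@frac_unique _ 1) -?addrA; [split => //|]; lra.
rewrite -measureU//; last first.
  by apply/seteqP; split=> x //= -[[_]]; rewrite !in_itv/= => h1 [_ h2]; lra.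
congr (leb _); apply/seteqP; split=> x /=; rewrite !in_itv/=.
  by move=> [[Ax h]|[Ax h]]; split => //; lra.
move=> [Ax h]; have [xt|xt] := ltP x t; [right|left]; split => //; lra.
Qed.

Definition shift_tuple n (v x : n.-tuple mR) : n.-tuple mR :=
  [tuple frac (tnth x i + tnth v i) | i < n].

Lemma measurable_shift_tuple n v : measurable_fun setT (@shift_tuple n v).
Proof.
apply/measurable_fun_tnthP => i.
rewrite (_ : _ \o _ = frac \o (fun x : mR => x + tnth v i) \o (fun x => tnth x i)).
  apply: measurableT_comp; last exact: measurable_tnth.
  exact: (measurableT_comp measurable_frac (measurable_addr _)).
by apply/funext => x /=; rewrite tnth_mktuple.
Qed.

Lemma cube_prob_shift n (v : n.-tuple mR) (A : set (n.-tuple mR)) :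
  measurable A -> cube_prob n (shift_tuple v @^-1` A) = cube_prob n A.
Proof.
elim: n v A => [|n ih] v A mA.
  by congr (cube_prob 0 _); apply/seteqP; split => x /=; rewrite [shift_tuple v x]tuple0 [x]tuple0.
case/tupleP: v => v0 v; rewrite /= /distribution /pushforward.
pose g (p : mR * n.-tuple mR) : mR * n.-tuple mR :=
  (frac (p.1 + v0), shift_tuple v p.2).
have mg : measurable_fun setT g.
  apply: measurable_fun_pair.
    apply: (measurableT_comp measurable_frac).
    apply: (measurableT_comp (measurable_addr _)).
    exact: measurable_fst.
  apply: (measurableT_comp (measurable_shift_tuple _)).
  exact: measurable_snd.
have sg p : shift_tuple [tuple of v0 :: v] (cons_pair p) = cons_pair (g p).
  apply: eq_from_tnth => i; rewrite tnth_mktuple.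
  by case: (unliftP ord0 i) => [j ->|->]; rewrite ?tnth0// !tnthS/= tnth_mktuple.
have -> : @cons_pair n @^-1` (shift_tuple [tuple of v0 :: v] @^-1` A) =
    g @^-1` (@cons_pair n @^-1` A).
  by apply/seteqP; split => p /=; rewrite sg.
apply/esym.
apply: (@product_measure_unique _ _ _ _ _ (uniform_prob (@ltr01 R)) (cube_prob n)
  (pushforward (uniform_prob (@ltr01 R) \x cube_prob n)%E g)).
- move=> B C mB mC.
  transitivity ((uniform_prob (@ltr01 R) \x cube_prob n)%E
    (((fun x => frac (x + v0)) @^-1` B) `*` (shift_tuple v @^-1` C))) => //.
  rewrite product_measure1E.
  + by congr (_ * _)%E; [exact: uniform_frac|exact: ih].
  + rewrite -[X in measurable X]setTI.
    exact: (measurableT_comp measurable_frac (measurable_addr _)).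
  + by rewrite -[X in measurable X]setTI; exact: measurable_shift_tuple.
- rewrite -[X in measurable X]setTI; exact: measurable_cons_pair.
Qed.

End cube.

Section haar.
Context (R : realType) (m : nat).
Local Notation mR := (measurableTypeR R).

Definition borel_torus := g_sigma_algebraType (@open (torus R m)).

Definition toT_tuple (x : m.-tuple mR) : borel_torus := toT (tuple_col x).

Lemma measurable_toT_tuple : measurable_fun setT toT_tuple.
Proof.
apply: (@measurability _ _ _ borel_torus _ toT_tuple (@open (torus R m))) => //.
move=> _ [U oU <-]; rewrite setTI.
exact: (@measurable_open_tuple_col R m (@toT R m @^-1` U)).
Qed.

HB.instance Definition _ :=
  isMeasurableFun.Build _ _ _ _ toT_tuple measurable_toT_tuple.

(* The image of Lebesgue measure on the unit cube under R^m -> R^m / Z^m; it is the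
   translation-invariant Borel probability measure by [haar_translation]. *)
Definition haar : probability borel_torus R := distribution (cube_prob R m) toT_tuple.

Lemma haar_translation (a : torus R m) (A : set (torus R m)) :
  measurable (A : set borel_torus) -> haar [set a + x | x in A] = haar A.
Proof.
move=> mA.
have -> : [set a + x | x in A] = (fun x => x - a) @^-1` A.
  apply/seteqP; split => x /=; first by move=> [y Ay <-]; rewrite addrC addKr.
  by move=> Ax; exists (x - a) => //; rewrite addrC subrK.
rewrite /= /distribution /pushforward.
pose v : m.-tuple mR := [tuple - repr a i ord0 | i < m].
have shiftE x : toT_tuple (shift_tuple v x) = (toT_tuple x : torus R m) - a.
  apply/eqP; rewrite -{1}[a]toT_repr -toTB toT_eq; apply/mxOverP => i j.
  rewrite !mxE !tnth_mktuple (ord1 j) /frac addrAC subrr add0r.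
  by rewrite rpredN intr_int.
have -> : toT_tuple @^-1` ((fun x => x - a) @^-1` A) =
    shift_tuple v @^-1` (toT_tuple @^-1` A).
  by apply/seteqP; split=> x /=; rewrite shiftE.
apply: cube_prob_shift; rewrite -[X in measurable X]setTI.
exact: measurable_toT_tuple.
Qed.

End haar.

(* Main.v *)
Require Import Defs.
From HB Require Import structures.
From mathcomp Require Import all_boot all_order all_algebra.
From mathcomp Require Import all_classical all_reals all_analysis.
From mathcomp Require Import separable complex measurable_realfun ring lra.

(* A splitting [e = v + w] of an integer vector along the expanding line and the
   contracting hyperplane of [M] makes [v] (mod Z^m) homoclinic to 0: its orbit consists
   of the points [M^k v], k <= 0, and [- M^k w], k > 0, both tending to 0 exponentially.
   For widely spaced exponents, a sum of a subset of this orbit stays, under iteration, in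
   a small neighbourhood of the orbit and 0; letting the subset range over the binary
   expansions of t in [0, 1[ gives a Cantor set of positive dimension on the expanding
   line. With spacing N, the neighbourhood is covered by O(N) boxes of exponentially small
   size eta. The hole is the complement of the strip where coordinate 0 is eta-close to
   that of some box, together with a thin slab in another coordinate that misses all the
   boxes and connects the pieces. *)

Set Implicit Arguments.
Unset Strict Implicit.
Unset Printing Implicit Defensive.

Import Order.TTheory GRing.Theory Num.Theory numFieldNormedType.Exports.

Local Open Scope classical_set_scope.
Local Open Scope ring_scope.

Lemma nonroot_separable (F : fieldType) (L : fieldType) (f : {rmorphism F -> L})
    (p : {poly F}) (q : {poly L}) (x : L) :
  [pchar F] =i pred0 -> irreducible_poly p ->
  map_poly f p = q * ('X - x%:P) -> ~~ root q x.
Proof.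
move=> F0 irrp fp.
have sep_p : separable_poly p.
  rewrite unlock irreducible_poly_coprime//.
  have [sp _] := irrp.
  apply: contraTN sp => pdvd; rewrite -leqNgt.
  have [d0|d0] := eqVneq p^`() 0.
    apply/leq_sizeP => -[//|j] _; have : p^`()`_j = 0 by rewrite d0 coef0.
    rewrite coef_deriv -mulr_natr => /eqP; rewrite mulf_eq0 => /orP[/eqP//|].
    by rewrite (iffLR (pcharf0P F) F0).
  have := dvdp_leq d0 pdvd; rewrite leqNgt lt_size_deriv//.
  by apply: contraNneq d0 => ->; rewrite linear0.
have : separable_poly (map_poly f p) by rewrite separable_map.
by rewrite fp separable_root => /andP[].
Qed.

(* Each root [z] of the annihilating polynomial costs one step: [w = (A - z) u] is
   killed by one factor less, and [b_(k+1) <= |z| b_k + C theta^k] for the entries. *)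
Lemma horner_mx_decay (K : numFieldType) n (A : 'M[K]_n.+1) (rho theta : K)
    (s : seq K) (u : 'cV[K]_n.+1) :
  0 <= rho < theta -> {in s, forall z, `|z| <= rho} ->
  horner_mx A (\prod_(z <- s) ('X - z%:P)) *m u = 0 ->
  forall i, exists2 C, 0 <= C & forall k, `|(A ^+ k *m u) i 0| <= C * theta ^+ k.
Proof.
move=> /andP[rho0 rhot]; have t0 : 0 <= theta by apply: le_trans (ltW rhot).
elim: s u => [|z s ih] u hs.
  rewrite big_nil rmorph1 mul1mx => -> i; exists 0 => // k.
  by rewrite mulmx0 mxE normr0 mul0r.
rewrite big_cons mulrC rmorphM/= -mulmxE -mulmxA => hu i.
have [|C C0 hC] := ih (horner_mx A ('X - z%:P) *m u) _ hu i.
  by move=> y ys; apply: hs; rewrite inE ys orbT.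
have hz : `|z| <= rho by apply: hs; rewrite inE eqxx.
have d0 : 0 < theta - rho by rewrite subr_gt0.
exists (`|u i 0| + C / (theta - rho)).
  by rewrite addr_ge0// divr_ge0// ltW.
elim=> [|k ihk].
  by rewrite expr0 mul1mx mulr1 lerDl divr_ge0// ltW.
have -> : A ^+ k.+1 *m u =
    z *: (A ^+ k *m u) + A ^+ k *m (horner_mx A ('X - z%:P) *m u).
  rewrite rmorphB/= horner_mx_X horner_mx_C mulmxBl mulmxBr mul_scalar_mx.
  by rewrite -scalemxAr exprSr -mulmxE -mulmxA addrC subrK.
rewrite [X in `|X| <= _]mxE [X in `|X + _| <= _]mxE.
apply: le_trans (ler_normD _ _) _; rewrite normrM.
apply: (@le_trans _ _ (rho * ((`|u i 0| + C / (theta - rho)) * theta ^+ k) +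
    C * theta ^+ k)).
  by apply: lerD => //; apply: ler_pM.
rewrite exprS [X in _ <= X](_ : _ =
  rho * ((`|u i 0| + C / (theta - rho)) * theta ^+ k) + C * theta ^+ k +
  (theta - rho) * `|u i 0| * theta ^+ k); last by field; rewrite gt_eqF.
by rewrite lerDl !mulr_ge0 ?exprn_ge0// ltW.
Qed.

(** Only [|beta|] is constrained, so that [M] and [- M] are treated alike. One rate [theta] controls
    both the decay of [w] and [|beta|^-1]. *)
Definition hyperbolic_splitting (R : realType) n (M : 'M[int]_n.+1) : Prop :=
  exists (beta C theta : R) (v w : 'cV[R]_n.+1),
    [/\ [/\ 0 <= C, 0 < theta < 1, 1 < `|beta| & `|beta|^-1 <= theta],
        v != 0, map_mx intr M *m v = beta *: v, v + w \in @lattice R n.+1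
      & forall i k, `|(map_mx intr M ^+ k *m w) i 0| <= C * theta ^+ k].

Lemma hyperbolic_splittingN (R : realType) n (M : 'M[int]_n.+1) :
  hyperbolic_splitting R (- M) -> hyperbolic_splitting R M.
Proof.
move=> [b [C [t [v [w [[C0 t01 b1 bt] v0 Mv vw hw]]]]]].
exists (- b), C, t, v, w; split => //.
- by rewrite normrN.
- by rewrite -[M]opprK map_mxN mulNmx Mv scaleNr.
move=> i k; apply: le_trans (hw i k); rewrite map_mxN exprNn -signr_odd.
by case: odd; rewrite ?mul1r// mulN1r mulNmx [X in _ <= `|X|]mxE normrN.
Qed.

Lemma roots_modulus_bound (R : rcfType) (s : seq R[i]) :
  {in s, forall z, `|z| < 1} ->
  exists2 rho : R, 0 <= rho < 1 & {in s, forall z, `|z| <= rho%:C%C}.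
Proof.
elim: s => [|z s ih] hs; first by exists 0 => [|z //]; rewrite lexx ltr01.
have [|rho /andP[r0 r1] hr] := ih.
  by move=> y ys; apply: hs; rewrite inE ys orbT.
have := hs z (mem_head _ _); rewrite normc_def.
set r := Num.sqrt _; rewrite -[1]/(1%:C)%C ltcR => z1.
exists (Num.max rho r); first by rewrite le_max r0/= gt_max r1.
move=> y; rewrite inE => /predU1P[->|/hr]; rewrite ?normc_def !lecR le_max ?lexx ?orbT//.
by move=> ->.
Qed.

(** Factor the characteristic polynomial as [q * ('X - beta)]. Then [q(M) / q(beta)] projects onto
    the eigenline of [beta]. Applied to a basis vector [e] it gives [v], and [w = e - v] is killed
    by [q(M)], hence decays. *)
Lemma pisot_splitting (R : realType) n (M : 'M[int]_n.+1) :
  pisot R M -> hyperbolic_splitting R M.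
Proof.
move=> [irr [beta [beta1 rootb others]]].
set A : 'M[R]_n.+1 := map_mx intr M.
have chiA : char_poly A = map_poly intr (char_poly M) by rewrite map_char_poly.
have [q chiq] : exists q, char_poly A = q * ('X - beta%:P).
  by apply/factor_theorem; rewrite chiA.
have qb : ~~ root q beta.
  apply: (@nonroot_separable _ _ (ratr : {rmorphism rat -> R}) _ q beta _ irr).
    exact: pchar_num.
  rewrite -chiq chiA -map_poly_comp; apply: eq_map_poly => z /=.
  by rewrite ratr_int.
have qb0 : q.[beta] != 0 by [].
have eigb : eigenvalue A^T beta.
  have trE : (char_poly_mx A^T)^T = char_poly_mx A.
    by apply/matrixP => i j; rewrite !mxE eq_sym.
  by rewrite eigenvalue_root_char /char_poly -det_tr trE -/(char_poly A) chiA.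
(* [q(M)] is nonzero because it multiplies an eigenvector by [q.[beta] != 0]. *)
have [j vj] : exists j, col j (horner_mx A q) != 0.
  apply/existsP; apply: contraNT qb0 => /existsPn h.
  have q0 : horner_mx A q = 0.
    apply/matrixP => i j; have /negPn/eqP := h j.
    by move=> /(congr1 (fun u : 'cV_n.+1 => u i 0)); rewrite !mxE.
  have /eigenvalueP[x xA x0] := eigb.
  have Ax : A *m x^T = beta *: x^T by rewrite -linearZ/= -xA trmx_mul trmxK.
  have hx (p : {poly R}) : horner_mx A p *m x^T = p.[beta] *: x^T.
    elim/poly_ind: p => [|p c ih]; first by rewrite rmorph0 mul0mx horner0 scale0r.
    rewrite rmorphD rmorphM/= horner_mx_X horner_mx_C mulmxDl -mulmxE -mulmxA Ax.
    by rewrite -scalemxAr ih mul_scalar_mx scalerA -scalerDl hornerMXaddC mulrC.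
  have := hx q; rewrite q0 mul0mx => /esym/eqP; rewrite scaler_eq0.
  by rewrite trmx_eq0 (negPf x0) orbF.
pose e : 'cV[R]_n.+1 := delta_mx j 0.
pose v := q.[beta]^-1 *: (horner_mx A q *m e).
have Aqe : A *m (horner_mx A q *m e) = beta *: (horner_mx A q *m e).
  apply/eqP; rewrite -subr_eq0 -mul_scalar_mx -mulmxBl.
  rewrite -[A in A - _]horner_mx_X -(horner_mx_C A) -rmorphB/= mulmxA mulmxE.
  by rewrite -rmorphM/= mulrC -chiq Cayley_Hamilton mul0mx.
(* ['X - beta] divides [q.[beta] - q], so applying [q(M)] produces a multiple of the characteristic
   polynomial. *)
have qwe : horner_mx A q *m (e - v) = 0.
  have [r rE] : exists r, q.[beta]%:P - q = r * ('X - beta%:P).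
    by apply/factor_theorem; rewrite /root !hornerE subrr.
  have -> : e - v = q.[beta]^-1 *: (horner_mx A (r * ('X - beta%:P)) *m e).
    rewrite -rE rmorphB/= horner_mx_C mulmxBl scalerBr mul_scalar_mx scalerA.
    by rewrite mulVf// scale1r.
  rewrite -scalemxAr mulmxA mulmxE -rmorphM/= mulrCA -chiq rmorphM/=.
  by rewrite Cayley_Hamilton mulr0 mul0mx scaler0.
pose toC := map_mx (real_complex R).
have [s sE] : exists s, map_poly (real_complex R) q = \prod_(z <- s) ('X - z%:P).
  have [s sE] := closed_field_poly_normal (map_poly (real_complex R) q).
  exists s; rewrite sE; suff -> : lead_coef (map_poly (real_complex R) q) = 1.
    by rewrite scale1r.
  rewrite lead_coef_map; have := char_poly_monic A.
  by rewrite chiq monicMr ?monicXsubC// => /monicP ->.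
have s1 : {in s, forall z, `|z| < 1}.
  move=> z zs; have rz : root (map_poly (real_complex R) q) z.
    by rewrite sE root_prod_XsubC.
  apply: others.
    have -> : map_poly intr (char_poly M) =
        map_poly (real_complex R) (char_poly A) :> {poly R[i]}.
      by rewrite chiA -map_poly_comp; apply: eq_map_poly => k /=; rewrite rmorph_int.
    by rewrite chiq rmorphM/= rootM rz.
  apply: contraNneq qb => zb; move: rz.
  by rewrite zb (fmorph_root (real_complex R)).
have [rho /andP[rho0 rho1] hrho] := roots_modulus_bound s1.
(* The midpoint of [rho] and 1 leaves the strict gap needed for the decay; the maximum secures
   [beta^-1 <= t]. *)
pose t := Num.max ((1 + rho) / 2) beta^-1.
have b0 : 0 < beta by apply: lt_trans beta1.
have t1 : t < 1 by rewrite gt_max invf_lt1// beta1 andbT; lra.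
have rt : rho < t by rewrite lt_max; apply/orP; left; lra.
(* The decay is obtained over [R[i]], where [q] splits; it returns to [R] through the real parts of
   the constants. *)
have /choice[C hC] : forall i : 'I_n.+1, exists C : R[i], 0 <= C /\
    forall k, `|(toC n.+1 n.+1 A ^+ k *m toC _ _ (e - v)) i 0| <= C * t%:C%C ^+ k.
  move=> i.
  have [||C C0 hC] := @horner_mx_decay _ _ (toC _ _ A) rho%:C%C t%:C%C s
      (toC _ _ (e - v)) _ hrho _ i.
  - by rewrite lecR ltcR rho0.
  - rewrite -sE /toC -map_horner_mx -map_mxM qwe.
    by apply/matrixP => ? ?; rewrite !mxE rmorph0.
  by exists C.
exists beta, (\sum_i complex.Re (C i)), t, v, (e - v); split.
- rewrite (gtr0_norm b0) beta1 t1 le_max lexx orbT.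
  split=> //.
    by apply: sumr_ge0 => i _; have [+ _] := hC i; rewrite lecE => /andP[].
  by rewrite andbT (le_lt_trans rho0).
- rewrite /v scaler_eq0 invr_eq0 (negPf qb0)/=.
  by rewrite -colE.
- by rewrite -scalemxAr Aqe scalerA mulrC -scalerA.
- rewrite addrC subrK; apply/mxOverP => a b.
  by rewrite mxE; case: (_ && _); rewrite ?rpred1 ?rpred0.
move=> i k; have [Ci0 /(_ k)] := hC i.
have -> : toC _ _ A ^+ k *m toC _ _ (e - v) = toC _ _ (A ^+ k *m (e - v)).
  by rewrite /toC map_mxM rmorphXn.
rewrite mxE normc_def /= expr0n addr0 sqrtr_sqr -(rmorphXn (real_complex R))/= => h.
apply: (@le_trans _ _ (complex.Re (C i) * t ^+ k)).
  by move: h; rewrite -[C i](RRe_real (ger0_real Ci0)) -rmorphM lecR.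
rewrite ler_wpM2r ?exprn_ge0 ?(le_trans rho0 (ltW rt))//.
rewrite (bigD1 i)//= lerDl sumr_ge0// => l _.
by have [+ _] := hC l; rewrite lecE => /andP[].
Qed.

(** * A Cantor function on binary expansions *)

Lemma expr_lt_eventually (R : realType) (x e : R) : 0 <= x < 1 -> 0 < e ->
  exists N, forall n, (N <= n)%N -> x ^+ n < e.
Proof.
move=> /andP[x0 x1] e0; have : `|x| < 1 by rewrite ger0_norm.
move=> /cvg_expr/cvgrPdist_lt/(_ e e0)[N _ hN]; exists N => n /hN/=.
by rewrite sub0r normrN ger0_norm ?exprn_ge0.
Qed.

Definition binary_digit (R : realType) (t : R) : bool := 1 / 2 <= t.
Definition binary_shift (R : realType) (t : R) : R := 2 * t - (binary_digit t)%:R.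

Lemma binary_shift_itv (R : realType) (t : R) :
  0 <= t < 1 -> 0 <= binary_shift t < 1.
Proof. by rewrite /binary_shift /binary_digit; case: (leP (1 / 2)) => /=; lra. Qed.

(* [s t] is [\sum_(j >= 1) b_j lam ^+ j], where the [b_j] are the binary digits of [t]. *)
Lemma cantor_function (R : realType) (lam : R) : 0 < lam <= 1 / 2 ->
  exists s : R -> R, forall t, 0 <= s t <= 2 * lam /\
    s t = lam * ((binary_digit t)%:R + s (binary_shift t)).
Proof.
move=> /andP[l0 l1].
(* [p n] reads the first [n] digits. It increases with [n] and is at most [2 * lam], since
   [lam * (1 + 2 * lam) <= 2 * lam]. *)
pose p := fix p (n : nat) (t : R) : R := if n is n'.+1 then
  lam * ((binary_digit t)%:R + p n' (binary_shift t)) else 0.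
have b01 (t : R) : 0 <= ((binary_digit t)%:R : R) <= 1.
  by case: (binary_digit t); rewrite ?lexx ler01.
have p_ge0 n t : 0 <= p n t.
  elim: n t => [|n ih] t //=; have /andP[b0 b1] := b01 t.
  by apply: mulr_ge0; [exact: ltW|exact: addr_ge0].
have p_le n t : p n t <= 2 * lam.
  elim: n t => [|n ih] t /=; first by rewrite mulr_ge0// ltW.
  rewrite mulrC ler_wpM2r ?(ltW l0)//; have := ih (binary_shift t).
  by have := b01 t; move: (_%:R) => b; lra.
have p_step n t : p n t <= p n.+1 t.
  elim: n t => [|n ih] t; first exact: p_ge0.
  by rewrite [X in X <= _]/= [X in _ <= X]/= ler_pM2l// lerD2l.
have p_homo t : nondecreasing_seq (fun n => p n t).
  by apply/nondecreasing_seqP => n; exact: p_step.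
have p_cvg t : cvgn (fun n => p n t).
  apply: nondecreasing_is_cvgn => //; exists (2 * lam) => _ [n _ <-].
  exact: p_le.
exists (fun t => limn (fun n => p n t)) => t; split.
  apply/andP; split.
    by apply: limr_ge => //; apply: nearW => n; exact: p_ge0.
  by apply: limr_le => //; apply: nearW => n; exact: p_le.
apply/cvg_lim => //; rewrite -cvg_shiftS/=.
by apply: cvgM; [exact: cvg_cst|apply: cvgD; [exact: cvg_cst|exact: p_cvg]].
Qed.

(** If the first digits differ, the values are at least [lam * (1 - 2 * lam) >= lam / 2] apart. If
    they agree, shifting doubles [|t - t'|] and divides [|s t - s t'|] by [lam], which lowers [J] by
    one. *)
Lemma cantor_separation (R : realType) (lam : R) (s : R -> R) :
  0 < lam <= 1 / 4 ->
  (forall t, 0 <= s t <= 2 * lam /\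
    s t = lam * ((binary_digit t)%:R + s (binary_shift t))) ->
  forall J t t', 0 <= t < 1 -> 0 <= t' < 1 -> 2^-1 ^+ J <= `|t - t'| ->
    2^-1 * lam ^+ J <= `|s t - s t'|.
Proof.
move=> /andP[l0 l1] hs; elim=> [|J ih] t t' ht ht'.
  (* Vacuous for [J = 0]: two points of [[0, 1[] are less than 1 apart. *)
  rewrite expr0 ler_normr => h; exfalso; lra.
have lJ1 : lam ^+ J <= 1 by rewrite exprn_ile1 ?(ltW l0)//; lra.
have [_ st] := hs t; have [_ st'] := hs t'.
have sep (x y : R) : x = lam * (1 + s (binary_shift t)) \/
    x = lam * (1 + s (binary_shift t')) ->
    y = lam * (0 + s (binary_shift t')) \/ y = lam * (0 + s (binary_shift t)) ->
    2^-1 * lam ^+ J.+1 <= x - y.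
  have := hs (binary_shift t); have := hs (binary_shift t').
  move=> [+ _] [+ _]; move: (s _) (s _) => c d hc hd hx hy.
  have {hx hy} : lam * (1 - 2 * lam) <= x - y.
    have cl : 0 <= lam * c by rewrite mulr_ge0 ?(ltW l0)//; lra.
    have dl : 0 <= lam * d by rewrite mulr_ge0 ?(ltW l0)//; lra.
    have cl2 : lam * c <= lam * (2 * lam) by rewrite ler_pM2l//; lra.
    have dl2 : lam * d <= lam * (2 * lam) by rewrite ler_pM2l//; lra.
    by case: hx => ->; case: hy => ->; lra.
  apply: le_trans; rewrite exprS mulrCA ler_pM2l//; lra.
have shiftE : binary_digit t = binary_digit t' ->
    `|binary_shift t - binary_shift t'| = 2 * `|t - t'|.
  move=> e; rewrite /binary_shift e opprD addrACA opprK addNr addr0 -mulrBr.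
  by rewrite normrM ger0_norm.
case: (boolP (binary_digit t)) shiftE => bt; rewrite ?(negPf bt);
    case: (boolP (binary_digit t')) => bt' shiftE.
- move=> h; rewrite st st' bt bt' -mulrBr opprD addrACA subrr add0r normrM.
  rewrite (gtr0_norm l0) exprS mulrCA ler_pM2l//; apply: ih; rewrite ?binary_shift_itv//.
  by rewrite shiftE//; move: h; rewrite exprS; lra.
- move=> _; apply: (le_trans _ (ler_norm _)).
  by apply: sep; [left; rewrite st bt|left; rewrite st' (negPf bt')].
- move=> _; rewrite distrC; apply: (le_trans _ (ler_norm _)).
  by apply: sep; [right; rewrite st' bt'|right; rewrite st (negPf bt)].
- move=> h; rewrite st st' (negPf bt) (negPf bt') -mulrBr opprD addrACA subrr add0r.
  rewrite normrM (gtr0_norm l0) exprS mulrCA ler_pM2l//.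
  apply: ih; rewrite ?binary_shift_itv//.
  by rewrite shiftE//; move: h; rewrite exprS; lra.
Qed.

(** * A lower bound for Hausdorff dimension *)

Lemma lebesgue_countable_cover (R : realType) (A : set R) (I : (set R)^nat)
    (u : (\bar R)^nat) :
  measurable A -> (forall i, measurable (I i)) ->
  (forall i, (lebesgue_measure (I i) <= u i)%E) -> A `<=` \bigcup_i I i ->
  (lebesgue_measure A <= \sum_(0 <= i <oo) u i)%E.
Proof.
move=> mA mI Iu AI.
apply: (@le_trans _ _ (\sum_(0 <= i <oo) lebesgue_measure (I i))%E).
  exact: measure_sigma_subadditive.
by apply: lee_nneseries => // i _ _; exact: measure_ge0.
Qed.

(* A mass distribution principle, with Lebesgue measure on [[0, 1[] transported by [g]. *)
Lemma hausdorff_dim_gt0 (R : realType) (T : Type) (dist : T -> T -> R)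
    (A : set T) (g : R -> T) (c lam : R) :
  0 < c -> 0 < lam < 1 -> (forall t, 0 <= t < 1 -> A (g t)) ->
  (forall J t t', 0 <= t < 1 -> 0 <= t' < 1 -> 2^-1 ^+ J <= `|t - t'| ->
    c * lam ^+ J <= dist (g t) (g t')) ->
  (0 < hausdorff_dim dist A)%E.
Proof.
move=> c0 /andP[l0 l1] Ag sep.
have lnl0 : ln lam < 0 by rewrite ln_lt0// l0.
(* The similarity dimension: a set of diameter about [lam ^+ J] carries mass about [2^-1 ^+ J] at
   most. *)
pose s0 := ln 2^-1 / ln lam.
have s00 : 0 < s0.
  by rewrite nmulr_rgt0 ?invr_lt0// ln_lt0// invr_gt0 ltr0n/= invf_lt1// ltr1n.
have lams0 : lam `^ s0 = 2^-1.
  rewrite /powR gt_eqF// divfK ?lt_eqF// lnK// posrE invr_gt0.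
  by rewrite ltr0n.
suff key s : 0 < s < s0 -> hausdorff_measure dist s A <> 0%E.
  apply: (@lt_le_trans _ _ s0%:E); first by rewrite lte_fin.
  apply/ereal_infP => _ [s [sgt0 sA] <-]; rewrite lee_fin leNgt.
  by apply/negP => ss0; apply: (key s) sA; rewrite sgt0.
move=> /andP[sgt0 ss0].
pose K := 4 * (c^-1) `^ s.
have K0 : 0 < K by rewrite mulr_gt0// powR_gt0// invr_gt0.
have piece (U : set T) : (diam dist U <= (c / 2)%:E)%E ->
    exists I : set R, [/\ measurable I,
      forall t, 0 <= t < 1 -> U (g t) -> I t &
      (lebesgue_measure I <= K%:E * diam dist U `^ s)%E].
  move=> dU.
  (* With at most one parameter sent into [U], a null set [I] serves, whatever the diameter. *)
  have [[t0 [ht0 Ut0]]|noU] := pselect (exists t, 0 <= t < 1 /\ U (g t));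
      last first.
    exists set0; split=> [//|t ht Ut|].
      by apply: noU; exists t.
    by rewrite measure0 mule_ge0 ?poweR_ge0// lee_fin ltW.
  have dle t t' : U (g t) -> U (g t') -> ((dist (g t) (g t'))%:E <= diam dist U)%E.
    by move=> Ut Ut'; apply: ereal_sup_ubound; exists (g t, g t').
  have [[t1 [ht1 Ut1 t10]]|single] :=
      pselect (exists t, [/\ 0 <= t < 1, U (g t) & t != t0]); last first.
    exists [set t0]; split=> [|t ht Ut|].
    - exact: measurable_set1.
    - by apply: contrapT => /eqP tt0; apply: single; exists t.
    - by rewrite lebesgue_measure_set1 mule_ge0 ?poweR_ge0// lee_fin ltW.
  have d01 : 0 < dist (g t1) (g t0).
    have [||J hJ] := @expr_lt_eventually R 2^-1 `|t1 - t0|.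
    - by rewrite invr_ge0 ler0n invf_lt1// ltr1n.
    - by rewrite normr_gt0 subr_eq0.
    apply: (lt_le_trans _ (sep J t1 t0 ht1 ht0 (ltW (hJ _ (leqnn _))))).
    by rewrite mulr_gt0// exprn_gt0.
  case: (diam dist U) dU dle => [d| |]//; last first.
    by move=> _ /(_ _ _ Ut1 Ut0).
  rewrite lee_fin => dc dle.
  have d0 : 0 < d by apply: lt_le_trans d01 _; rewrite -lee_fin dle.
  (* [J.+1] is the least exponent [n] with [c * lam ^+ n <= d]; 0 is excluded since [d <= c / 2]. *)
  have [J hJ Jmin] : exists2 J, c * lam ^+ J.+1 <= d & d < c * lam ^+ J.
    have ex : exists n, c * lam ^+ n <= d.
      have [||N hN] := @expr_lt_eventually R lam (d / c).
      - by rewrite (ltW l0).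
      - by rewrite divr_gt0.
      by exists N; rewrite mulrC -ler_pdivlMr// ltW// hN.
    case: (ex_minnP ex) => -[|J] hJ Jmin.
      by move: hJ; rewrite expr0; lra.
    by exists J => //; rewrite ltNge; apply/negP => /Jmin; rewrite ltnn.
  (* Parameters at distance [2^-1 ^+ J] or more have images at least [c * lam ^+ J > d] apart. The
     factor 4 in [K] is the length of this ball divided by [2^-1 ^+ J.+1]. *)
  exists (ball t0 (2^-1 ^+ J)); split=> [|t ht Ut|].
  - by apply: open_measurable; apply: ball_open; rewrite exprn_gt0// invr_gt0.
  - rewrite /ball/= ltNge; apply/negP => /(sep _ _ _ ht0 ht).
    by have := dle _ _ Ut0 Ut; rewrite lee_fin; lra.
  rewrite lebesgue_measure_ball ?exprn_ge0 ?invr_ge0// poweR_EFin lee_fin.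
  have -> : 2^-1 ^+ J *+ 2 = 4 * 2^-1 ^+ J.+1 :> R by rewrite exprS -mulr_natl; lra.
  rewrite -mulrA ler_pM2l// -powRM ?invr_ge0 ?(ltW c0) ?(ltW d0)//.
  (* [2^-1 ^+ J.+1] is the [s0]-th power of [lam ^+ J.+1 <= 1], and [s < s0]. *)
  apply: (@le_trans _ _ ((lam ^+ J.+1) `^ s)).
    rewrite -lams0 -[X in X <= _]powR_mulrn ?powR_ge0// -powRrM mulrC powRrM.
    rewrite powR_mulrn ?(ltW l0)//; apply: ger_powR; last exact: ltW.
    by rewrite exprn_gt0//= exprn_ile1 ?ltW.
  apply: ge0_ler_powR; rewrite ?nnegrE ?exprn_ge0 ?mulr_ge0 ?invr_ge0 ?(ltW l0)
    ?(ltW sgt0) ?(ltW c0) ?(ltW d0)//.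
  by rewrite mulrC ler_pdivlMr// mulrC.
apply/eqP; rewrite gt_eqF//.
apply: (@lt_le_trans _ _ (hausdorff_premeasure dist s (c / 2) A)); last first.
  by apply: ereal_sup_ubound; exists (c / 2) => //=; rewrite divr_gt0.
apply: (@lt_le_trans _ _ (K^-1)%:E); first by rewrite lte_fin invr_gt0.
apply/ereal_infP => _ [U [dU AU] <-].
have /choice[I hI] : forall i, exists I : set R, [/\ measurable I,
      forall t, 0 <= t < 1 -> U i (g t) -> I t &
      (lebesgue_measure I <= K%:E * diam dist (U i) `^ s)%E].
  by move=> i; apply: piece.
have : (lebesgue_measure (`[0%R, 1%R[%classic : set R) <=
    \sum_(0 <= i <oo) (K%:E * diam dist (U i) `^ s))%E.
  apply: (lebesgue_countable_cover (I := I)) => [//|i|i|t].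
  - by have [] := hI i.
  - by have [] := hI i.
  rewrite /= in_itv/= => ht; have [i _ Ui] := AU _ (Ag _ ht).
  by exists i => //; have [_ h _] := hI i; exact: h.
rewrite lebesgue_measure_itv/= lte_fin ltr01 -EFinB subr0.
rewrite nneseriesZl; last by move=> i _; exact: poweR_ge0.
by rewrite -lee_pdivrMl// mule1.
Qed.

(** * Fractional parts and the measure of cylinders *)

Lemma frac_le (R : realType) (x r : R) (k : int) :
  0 <= x - k%:~R <= r -> r < 1 -> Defs.frac x <= r.
Proof. by move=> h r1; rewrite (@frac_unique _ _ k); lra. Qed.

(** [frac] is discontinuous only at the integers, where it vanishes; [0 <= r] keeps them out of the
    set. *)
Lemma open_frac_gt (R : realType) (r : R) : 0 <= r -> open [set x : R | r < Defs.frac x].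
Proof.
move=> r0; rewrite (_ : [set _ | _] = \bigcup_k `]r + k%:~R, (k + 1)%:~R[%classic).
  by apply: bigcup_open => k _; exact: interval_open.
apply/seteqP; split => x /=.
  move=> rx; exists (Num.floor x) => //=; rewrite in_itv/= intrD.
  by have := frac_itv x; move: rx; rewrite /Defs.frac; lra.
move=> [k _] /=; rewrite in_itv/= intrD => h.
by rewrite (@frac_unique _ _ k); lra.
Qed.

(** A union bound: by translation invariance modulo 1, each [t] excludes measure at most [r]. It
    serves both to measure the hole and to place the slab. *)
Lemma uniform_frac_avoid (R : realType) (s : seq R) (r : R) : 0 <= r ->
  let A := [set x : measurableTypeR R | forall t, t \in s -> r < Defs.frac (x + t)] in
  measurable A /\ ((1 - (size s)%:R * r)%:E <= uniform_prob (@ltr01 R) A)%E.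
Proof.
move=> r0 A.
pose B (s : seq R) := [set x : measurableTypeR R | exists2 t, t \in s & Defs.frac (x + t) <= r].
have mB1 t : measurable ((fun x : measurableTypeR R => Defs.frac (x + t)) @^-1`
    `]-oo, r]%classic).
  rewrite -[X in measurable X]setTI.
  by apply: (measurableT_comp (@measurable_frac R) (measurable_addr t)).
have [mB leB] : measurable (B s) /\
    (uniform_prob (@ltr01 R) (B s) <= ((size s)%:R * r)%:E)%E.
  elim: s {A} => [|t s [mBs ih]] /=.
    have -> : B [::] = set0 by apply/seteqP; split=> x // -[].
    by rewrite measure0 mul0r.
  have -> : B (t :: s) =
      (fun x : measurableTypeR R => Defs.frac (x + t)) @^-1` `]-oo, r]%classic `|` B s.
    apply/seteqP; split=> x /=; rewrite in_itv/=.
      by move=> [t']; rewrite inE => /predU1P[->|ts] h; [left|right; exists t'].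
    move=> [h|[t' ts h]]; first by exists t; rewrite ?mem_head.
    by exists t' => //; rewrite inE ts orbT.
  split; first exact: measurableU.
  apply: (le_trans (measureU2 _ (mB1 t) mBs)).
  rewrite -natr1 mulrDl mul1r addrC EFinD; apply: leeD => //.
  have mr : measurable (`]-oo, r]%classic : set (measurableTypeR R)) by [].
  rewrite [X in (X <= _)%E](uniform_frac t mr) uniform_probE//.
  apply: (@le_trans _ _ (lebesgue_measure (`[0%R, r]%classic : set R))).
    apply: le_measure; rewrite ?inE//; first exact: measurableI.
    by move=> x /=; rewrite !in_itv/= => -[-> /andP[->]].
  rewrite lebesgue_measure_itv/= lte_fin -EFinB subr0.
  by case: ifP => //; rewrite lee_fin.
have AE : A = ~` B s.
  apply/seteqP; split => x /=.
    by move=> h [t /h]; rewrite ltNge => /negP.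
  by move=> h t ts; rewrite ltNge; apply/negP => hx; apply: h; exists t.
split; first by rewrite AE; exact: measurableC.
by rewrite AE probability_setC// EFinB leeB.
Qed.

(** In the cube coordinates, the preimage of [H] contains the cylinder over [B]. *)
Lemma haar_ge_marginal (R : realType) n (H : set (torus R n.+1))
    (B : set (measurableTypeR R)) :
  open H -> measurable B -> (forall x : 'cV[R]_n.+1, B (x ord0 ord0) -> H (toT x)) ->
  (uniform_prob (@ltr01 R) B <= haar R n.+1 H)%E.
Proof.
move=> oH mB BH.
have mH : measurable (H : set (borel_torus R n.+1)) by exact: sub_sigma_algebra.
have mpre : measurable (@cons_pair R n @^-1` (@toT_tuple R n.+1 @^-1` H)).
  rewrite -[X in measurable X]setTI.
  apply: (measurableT_comp (@measurable_toT_tuple R n.+1) (@measurable_cons_pair R n)) => //.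
have <- : ((uniform_prob (@ltr01 R) \x cube_prob R n) (B `*` setT) =
    uniform_prob (@ltr01 R) B)%E.
  by rewrite product_measure1E// [X in (_ * X)%E]probability_setT mule1.
apply: (@le_measure _ _ _ (uniform_prob (@ltr01 R) \x cube_prob R n)%E).
- by rewrite inE; exact: measurableX.
- by rewrite inE.
move=> [x0 x] /= [Bx0 _]; apply: BH.
by rewrite mxE tnth0.
Qed.

(** * Connected holes in the torus *)

Lemma continuous_toT (R : realType) m : continuous (@toT R m).
Proof. exact: pi_continuous. Qed.

Lemma open_image_toT (R : realType) n (P : set 'cV[R]_n.+1) :
  open P -> open (@toT R n.+1 @` P).
Proof.
move=> oP; rewrite open_torusE.
rewrite (_ : _ @^-1` _ = \bigcup_(z in [set z | z \in @lattice R n.+1])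
   (fun x => x + z) @^-1` P).
  apply: bigcup_open => z _; apply: open_comp => // x _.
  by apply: (@continuousD _ _ _ id (cst z)); [exact: cvg_id|exact: cst_continuous].
apply/seteqP; split=> x /=.
  move=> [y Py /eqP]; rewrite toT_eq => h; exists (y - x) => //=.
  by rewrite addrC subrK.
move=> [z /= zL Pxz]; exists (x + z) => //; apply/eqP.
by rewrite toT_eq addrC addKr.
Qed.

Definition toral_segment (R : realType) m (x y : 'cV[R]_m) : set (torus R m) :=
  (fun t : R => toT (x + t *: (y - x))) @` `[0, 1]%classic.

Lemma toral_segment_connected (R : realType) n (x y : 'cV[R]_n.+1) :
  connected (toral_segment x y).
Proof.
apply: connected_continuous_connected; first exact: segment_connected.
apply: continuous_subspaceT => t.
apply: (@continuous_comp _ _ _ (fun t : R => x + t *: (y - x))); last exact: continuous_toT.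
apply: cvgD; first exact: cvg_cst.
by apply: cvgZ; [exact: cvg_id|exact: cvg_cst].
Qed.

Lemma toral_segment_left (R : realType) m (x y : 'cV[R]_m) :
  toral_segment x y (toT x).
Proof. by exists 0; rewrite /= ?in_itv/= ?lexx ?ler01// scale0r addr0. Qed.

Lemma toral_segment_right (R : realType) m (x y : 'cV[R]_m) :
  toral_segment x y (toT y).
Proof.
by exists 1; rewrite /= ?in_itv/= ?lexx ?ler01// scale1r addrC subrK.
Qed.

Lemma connected_from_point (T : topologicalType) (p : T) (A : set T) :
  (forall x, A x -> exists C, [/\ connected C, C `<=` A, C x & C p]) ->
  connected A.
Proof.
move=> h; have -> : A = \bigcup_(C in [set C | [/\ connected C, C `<=` A & C p]]) C.
  apply/seteqP; split=> [x /h[C [cC CA Cx Cp]]|x [C [_ CA _] /CA]//].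
  by exists C.
apply: bigcup_connected => [|C []//].
by exists p => C [].
Qed.

(* The hole is a thin slab [|x_1 - c| < eta] together with all the circles parallel to
   the coordinate axis 1 whose coordinate 0 is away from the [f_0]; each of these circles
   crosses the slab, hence connectedness. *)
Lemma connected_hole (R : realType) n (F : seq 'cV[R]_n.+2) (eta eps : R) :
  0 < eta -> 4 * eta < 1 -> (size F)%:R * (4 * eta) < 1 ->
  (size F)%:R * (2 * eta) < eps ->
  exists H : set (torus R n.+2),
    [/\ open H, connected H, ((1 - eps)%:E < haar R n.+2 H)%E &
      forall f (u : 'cV[R]_n.+2), f \in F ->
        (forall i, `|u i ord0| <= eta) -> ~ H (toT (f + u))].
Proof.
move=> e0 e41 Fe1 Feps.
pose i1 : 'I_n.+2 := lift ord0 ord0.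
have [_ hc] := @uniform_frac_avoid R [seq 2 * eta - f i1 ord0 | f : 'cV[R]_n.+2 <- F]
  (4 * eta) (mulr_ge0 (ler0n _ _) (ltW e0)).
(* The set of good [c] has positive measure. The condition puts [c] more than [2 * eta] away from
   each [f_1] modulo 1: [eta] for the slab and [eta] for the box. *)
have [c {}hc] : exists c, forall f, f \in F -> 4 * eta < Defs.frac (c + (2 * eta - f i1 ord0)).
  apply: contrapT => /forallNP h; move: hc.
  rewrite (_ : [set _ | _] = set0); last first.
    apply/seteqP; split=> x //= hx; apply: (h x) => f fF.
    by apply: hx; apply/mapP; exists f.
  by rewrite measure0 lee_fin size_map; lra.
pose S := [set x : 'cV[R]_n.+2 | `|x i1 ord0 - c| < eta].
(* Adding [eta] moves the forbidden interval of radius [eta] about [f_0] to fractional parts in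
   [[0, 2 * eta]]. *)
pose G := [set x : 'cV[R]_n.+2 | forall f, f \in F ->
  2 * eta < Defs.frac (x ord0 ord0 + (eta - f ord0 ord0))].
have oS : open S.
  rewrite (_ : S = (fun x : 'cV[R]_n.+2 => x i1 ord0) @^-1` ball c eta); last first.
    by apply/seteqP; split=> x; rewrite /S /ball/= distrC.
  apply: open_comp; last exact: ball_open.
  by move=> x _; exact: coord_continuous.
have oG : open G.
  rewrite /G; elim: (F) => [|f F' ih].
    by rewrite (_ : [set _ | _] = setT); [exact: openT|apply/seteqP; split].
  rewrite (_ : [set _ | _] = (fun x : 'cV[R]_n.+2 => x ord0 ord0 + (eta - f ord0 ord0))
    @^-1` [set x | 2 * eta < Defs.frac x] `&` [set x : 'cV[R]_n.+2 | forall f, f \in F' ->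
    2 * eta < Defs.frac (x ord0 ord0 + (eta - f ord0 ord0))]).
    apply: openI => //; apply: open_comp; last by apply: open_frac_gt; lra.
    move=> x _; apply: (@continuousD _ _ _ (fun x : 'cV[R]_n.+2 => x ord0 ord0)).
      exact: coord_continuous.
    exact: cst_continuous.
  apply/seteqP; split=> x /=.
    by move=> h; split=> [|g gF]; apply: h; rewrite inE ?eqxx ?gF ?orbT.
  by move=> [h1 h2] g; rewrite inE => /predU1P[->|/h2].
have oH : open (@toT R n.+2 @` (S `|` G)) by apply: open_image_toT; exact: openU.
exists (@toT R n.+2 @` (S `|` G)); split=> //.
- pose p : 'cV[R]_n.+2 := const_mx c.
  have slab x : S x -> toral_segment x p `<=` @toT R n.+2 @` (S `|` G).
    move=> Sx _ [t + <-]; rewrite /= in_itv/= => /andP[t0 t1].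
    exists (x + t *: (p - x)) => //; left; rewrite /S/= !mxE.
    have -> : x i1 ord0 + t * (c - x i1 ord0) - c = (1 - t) * (x i1 ord0 - c) by ring.
    rewrite normrM ger0_norm; last lra.
    by apply: le_lt_trans Sx; apply: ler_piMl => //; lra.
  apply: (@connected_from_point _ (toT p)) => _ [x Px <-].
  have [Sx|Gx] := Px.
    exists (toral_segment x p); split.
    + exact: toral_segment_connected.
    + exact: slab.
    + exact: toral_segment_left.
    + exact: toral_segment_right.
  (* [y] is where the line through [x] in direction 1 meets the slab; coordinate 0 is constant on
     the way, so the segment stays in [G]. *)
  pose y : 'cV[R]_n.+2 := x + (c - x i1 ord0) *: delta_mx i1 ord0.
  exists (toral_segment x y `|` toral_segment y p); split.
  + apply: connectedU; [|exact: toral_segment_connected..].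
    by exists (toT y); split; [exact: toral_segment_right|exact: toral_segment_left].
  + rewrite subUset; split; last first.
      by apply: slab; rewrite /S/= !mxE !eqxx mulr1 addrC subrK subrr normr0.
    move=> _ [t _ <-]; exists (x + t *: (y - x)) => //; right => f fF.
    by rewrite !mxE /= mulr0 addr0 subrr mulr0 addr0; exact: Gx.
  + by left; exact: toral_segment_left.
  + by right; exact: toral_segment_right.
- have [mB hB] := @uniform_frac_avoid R [seq eta - f ord0 ord0 | f : 'cV[R]_n.+2 <- F]
    (2 * eta) (mulr_ge0 (ler0n _ _) (ltW e0)).
  apply: lt_le_trans (haar_ge_marginal oH mB _).
    by apply: lt_le_trans hB; rewrite lte_fin size_map; lra.
  move=> x Bx; exists x => //; right => f fF; apply: Bx.
  by apply/mapP; exists f.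
- move=> f u fF hu [x + /eqP]; rewrite toT_eq => Px /mxOverP zL.
  have xE i : exists k : int, x i ord0 = f i ord0 + u i ord0 + k%:~R.
    have /intrP[k] := zL i ord0; rewrite !mxE => kE; exists k.
    by apply/eqP; rewrite [X in _ == X]addrC -subr_eq; apply/eqP; exact: kE.
  (* A common point of slab and box would bring [c] within [2 * eta] of [f_1] modulo 1; points of
     [G] miss the box already in coordinate 0. *)
  case: Px => [|/(_ f fF)].
    have [k kE] := xE i1; rewrite /S/= kE.
    have := hu i1; rewrite ler_norml ltr_norml => /andP[u1 u2] /andP[h1 h2].
    have := hc f fF; rewrite ltNge => /negP; apply.
    by apply: (@frac_le _ _ _ k); lra.
  have [k kE] := xE ord0; rewrite kE; apply/negP; rewrite -leNgt.
  have := hu ord0; rewrite ler_norml => /andP[u1 u2].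
  by apply: (@frac_le _ _ _ k); lra.
Qed.

(** * Iterates of homoclinic sums and distances on the torus *)

(** Evenness will make [beta ^+ N] positive even for negative [beta]. For the smallness, one half of
    the power absorbs the factor [N] by a Bernoulli-type bound and the other half is small. *)
Lemma mul_expr_even_small (R : realType) (x e : R) : 0 < x < 1 -> 0 < e ->
  exists N, [/\ (0 < N)%N, ~~ odd N & N%:R * x ^+ N < e].
Proof.
move=> /andP[x0 x1] e0.
have bern k : k%:R * (1 - x) * x ^+ k <= 1 - x ^+ k.
  elim: k => [|k ih]; first by rewrite !mul0r expr0 subrr.
  have : x * (k%:R * (1 - x) * x ^+ k) <= x * (1 - x ^+ k) by rewrite ler_pM2l.
  have : 0 <= (1 - x) * (1 - x ^+ k.+1).
    by rewrite mulr_ge0 ?subr_ge0 ?exprn_ile1// ltW.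
  rewrite -natr1 !exprS; move: (x ^+ k) (k%:R) => a b; nra.
have [||K hK] := @expr_lt_eventually R x (e * (1 - x) / 2).
- by rewrite x1 ltW.
- by rewrite divr_gt0// mulr_gt0// subr_gt0.
exists (K.+1).*2; split => //; first by rewrite odd_double.
rewrite -addnn natrD exprD.
have := bern K.+1; have := hK _ (leqnSn K).
have : 0 < x ^+ K.+1 by rewrite exprn_gt0.
move: (x ^+ K.+1) (K.+1%:R) => a b a0 ha hb.
have : b * (1 - x) * a * a <= a.
  by rewrite -[X in _ <= X]mul1r ler_pM2r//; lra.
move=> h; rewrite -(ltr_pM2r (_ : 0 < 1 - x)) ?subr_gt0//; lra.
Qed.

Lemma dist_le_bound (R : realDomainType) (c x y : R) :
  0 <= x <= c -> 0 <= y <= c -> `|x - y| <= c.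
Proof. by move=> hx hy; rewrite ler_norml; lra. Qed.

(** A nonzero integer added to a number of modulus at most 1/2 leaves modulus at least 1/2, so
    lattice translations cannot shorten this coordinate. *)
Lemma tdist_ge_coord (R : realType) m (x y : 'cV[R]_m) i :
  `|x i ord0 - y i ord0| <= 2^-1 ->
  `|x i ord0 - y i ord0| <= tdist (toT x) (toT y).
Proof.
move=> h; apply: lb_le_inf.
  by exists (enorm (x - y)), (x, y).
move=> _ [[p q] /= [px qy] <-].
have /intrP[k kE] : (p - q - (x - y)) i ord0 \is a Num.int.
  have -> : p - q - (x - y) = (p - x) - (q - y).
    by apply/matrixP => a b; rewrite !mxE; ring.
  have pL : p - x \in @lattice R m by rewrite -toT_eq px.
  have qL : q - y \in @lattice R m by rewrite -toT_eq qy.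
  by rewrite mxE rpredD//; [exact: (mxOverP pL)|rewrite mxE rpredN; exact: (mxOverP qL)].
apply: (@le_trans _ _ `|(p - q) i ord0|).
  have -> : (p - q) i ord0 = x i ord0 - y i ord0 + k%:~R.
    by rewrite -kE !mxE; ring.
  have [->|k0] := eqVneq k 0; first by rewrite addr0.
  have : 1 <= `|k%:~R : R|.
    by rewrite -intr_norm -[1]/(1%:~R) ler_int -gtz0_ge1 normr_gt0.
  by have := lerB_normD (k%:~R : R) (x i ord0 - y i ord0); rewrite [_%:~R + _]addrC; lra.
rewrite -sqrtr_sqr /enorm ler_wsqrtr// (bigD1 i)//= lerDl sumr_ge0// => j _.
exact: sqr_ge0.
Qed.

Lemma iter_toral_map_toT (R : realType) n (M : 'M[int]_n.+1) k (x : 'cV[R]_n.+1) :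
  iter k (toral_map M) (toT x) = toT (map_mx intr M ^+ k *m x).
Proof.
elim: k => [|k ih]; first by rewrite expr0 mul1mx.
by rewrite iterS ih toral_map_toT exprS -mulmxE mulmxA.
Qed.

(** Inversion only reverses a two-sided orbit; this carries a hole found for the inverse back to
    [M]. *)
Lemma survivor_invmx (R : realType) m (M : 'M[int]_m) (H : set (torus R m)) :
  survivor (invmx M) H = survivor M H.
Proof.
rewrite /survivor; suff e : forall a : torus R m, orbit_of (invmx M) a = orbit_of M a.
  by apply/seteqP; split=> a /=; rewrite e.
move=> a; apply/seteqP; split=> _ [[[|k]|k] _ <-].
- by exists 0.
- by exists (Negz k).
- by exists (Posz k.+1) => //=; rewrite invmxK.
- by exists 0.
- by exists (Negz k) => //=; rewrite invmxK.
- by exists (Posz k.+1).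
Qed.

(** The centres of the boxes: [r] is the time modulo [N], [p.1] the next digit, still on the
    expanding line, and [p.2] the last digit passed, now in the contracting part. *)
Definition homoclinic_pieces (R : realType) n (A : 'M[R]_n.+1) (beta : R)
    (v w : 'cV[R]_n.+1) N : seq 'cV[R]_n.+1 :=
  [seq (p.1%:R * (beta ^+ r / beta ^+ N)) *: v - p.2%:R *: (A ^+ r *m w) |
    r : nat <- iota 0 N,
    p : bool * bool <- [:: (false, false); (false, true); (true, false); (true, true)]].

Lemma mem_homoclinic_pieces (R : realType) n (A : 'M[R]_n.+1) (beta : R)
    (v w : 'cV[R]_n.+1) N r (b b' : bool) : (r < N)%N ->
  (b%:R * (beta ^+ r / beta ^+ N)) *: v - b'%:R *: (A ^+ r *m w) \in
    homoclinic_pieces A beta v w N.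
Proof.
move=> rN; apply/allpairsP; exists (r, (b, b')); split=> //=.
  by rewrite mem_iota.
by case: b b' => -[].
Qed.

(* Modulo the integer vectors [v + w], the digit [b] of [s t] contributes [b beta^k v] to
   the [k]-th iterate while it lies in the future ([k <= 0]) and [- b A^k w] once it lies
   in the past; the digits are spaced by [N], so only two of them are not negligible. *)
Lemma orbit_near_pieces (R : realType) n (M : 'M[int]_n.+1) (beta C theta eta : R)
    (v w : 'cV[R]_n.+1) (s : R -> R) N :
  M \in unitmx -> (0 < N)%N -> 0 <= C -> 0 < theta < 1 -> 1 < `|beta| ->
  map_mx intr M *m v = beta *: v -> v + w \in @lattice R n.+1 ->
  (forall i k, `|(map_mx intr M ^+ k *m w) i ord0| <= C * theta ^+ k) ->
  (forall t, 0 <= s t <= 2 * (beta ^+ N)^-1 /\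
    s t = (beta ^+ N)^-1 * ((binary_digit t)%:R + s (binary_shift t))) ->
  (forall i, 2 * (beta ^+ N)^-1 * `|v i ord0| + C / (1 - theta) * theta ^+ N <= eta) ->
  forall t k, exists f (u : 'cV[R]_n.+1),
    [/\ f \in homoclinic_pieces (map_mx intr M) beta v w N,
        forall i, `|u i ord0| <= eta & toral_iter M k (toT (s t *: v)) = toT (f + u)].
Proof.
move=> Mu N0 C0 /andP[th0 th1] b1 Mv vwL hw hs heta t.
set A : 'M[R]_n.+1 := map_mx intr M in Mv hw *.
have b0 : beta != 0 by rewrite -normr_gt0 (lt_trans _ b1).
have th1' : 0 < 1 - theta by rewrite subr_gt0.
have CC0 : 0 <= C / (1 - theta) by rewrite divr_ge0// ltW.
have Av k : A ^+ k *m v = beta ^+ k *: v.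
  elim: k => [|k ih]; first by rewrite !expr0 mul1mx scale1r.
  by rewrite exprSr -mulmxE -mulmxA Mv -scalemxAr ih scalerA -exprS.
(* [P] will collect the digits before the last one passed; [C / (1 - theta)] bounds the geometric
   series of their contributions. *)
pose W (P : 'cV[R]_n.+1) := forall i k, `|(A ^+ k *m P) i ord0| <= C / (1 - theta) * theta ^+ k.
have W0 : W 0.
  by move=> i k; rewrite mulmx0 mxE normr0 mulr_ge0// exprn_ge0// ltW.
have WS P (b : bool) : W P -> W (A ^+ N *m P + b%:R *: w).
  move=> WP i k; rewrite mulmxDr mxE mulmxA mulmxE -exprD.
  apply: le_trans (ler_normD _ _) _.
  apply: (@le_trans _ _ (C / (1 - theta) * theta ^+ (k + N) + C * theta ^+ k)).
    apply: lerD; first exact: WP.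
    rewrite -scalemxAr mxE; case: b; rewrite ?mul1r// mul0r normr0.
    by rewrite mulr_ge0// exprn_ge0// ltW.
  have -> : C * theta ^+ k = C / (1 - theta) * (1 - theta) * theta ^+ k.
    by rewrite divfK// gt_eqF.
  have : theta ^+ N <= theta by rewrite -[X in _ <= X]expr1 ler_wiXn2l// ltW.
  rewrite exprD => thN; have : 0 <= theta ^+ k by rewrite exprn_ge0// ltW.
  move: (C / _) CC0 (theta ^+ k) (theta ^+ N) thN => c c0 x y yt x0.
  have : 0 <= (c * x) * (theta - y) by rewrite !mulr_ge0// subr_ge0.
  lra.
(* After [J] blocks of length [N], [t'] holds the digits to come, [b] the last one passed and [P]
   the older ones. *)
have claim J : exists P t' (b : bool), W P /\
    toT (A ^+ (J * N) *m (s t *: v)) = toT (s t' *: v - (A ^+ N *m P + b%:R *: w)).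
  elim: J => [|J [P [t' [b [WP ih]]]]].
    exists 0, t, false; split=> //.
    by rewrite mul0n expr0 mul1mx mulmx0 scale0r addr0 subr0.
  exists (A ^+ N *m P + b%:R *: w), (binary_shift t'), (binary_digit t').
  split; first exact: WS.
  rewrite mulSn exprD -mulmxE -mulmxA -iter_toral_map_toT ih iter_toral_map_toT.
  rewrite mulmxBr -scalemxAr Av scalerA (proj2 (hs t')) mulrAC mulVf ?expf_neq0//.
  rewrite mul1r; apply/eqP; rewrite toT_eq; move: (A ^+ N *m (_ + _)) => Q.
  (* A digit [d] that passes turns from [d v] into [- d w], at the cost of the integer vector
     [d (v + w)]. *)
  have -> : (((binary_digit t')%:R + s (binary_shift t')) *: v - Q) -
      (s (binary_shift t') *: v - (Q + (binary_digit t')%:R *: w)) =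
      (binary_digit t')%:R *: (v + w).
    by apply/matrixP => i j; rewrite !mxE; ring.
  by case: (binary_digit t'); rewrite ?scale1r// scale0r rpred0.
have lam1 r : (r <= N)%N -> `|beta ^+ r / beta ^+ N| <= 1.
  move=> rN; rewrite normrM normfV !normrX ler_pdivrMr ?mul1r ?exprn_gt0//.
    by rewrite ler_eXn2l.
  by rewrite (lt_trans _ b1).
have s_small t' : `|s t'| <= 2 * (beta ^+ N)^-1.
  by have [/andP[s0 s1] _] := hs t'; rewrite ger0_norm.
case=> k.
  have [P [t' [b [WP hJ]]]] := claim (k %/ N)%N.
  have rN : (k %% N < N)%N by rewrite ltn_mod.
  set r := (k %% N)%N in rN.
  have e : toral_iter M (Posz k) (toT (s t *: v)) =
      toT (A ^+ r *m (s t' *: v - (A ^+ N *m P + b%:R *: w))).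
    rewrite /= {1}(divn_eq k N) addnC iterD [X in iter _ _ X]iter_toral_map_toT hJ.
    exact: iter_toral_map_toT.
  exists (((binary_digit t')%:R * (beta ^+ r / beta ^+ N)) *: v - b%:R *: (A ^+ r *m w)).
  exists (((beta ^+ r / beta ^+ N) * s (binary_shift t')) *: v - A ^+ (r + N) *m P).
  split; first exact: mem_homoclinic_pieces.
    move=> i; rewrite mxE [X in _ + X]mxE; apply: le_trans (ler_normB _ _) _.
    apply: le_trans (heta i); apply: lerD.
      rewrite mxE normrM ler_wpM2r// normrM.
      apply: le_trans (s_small (binary_shift t')).
      by rewrite ler_piMl// lam1// ltnW.
    apply: le_trans (WP i (r + N)%N) _; rewrite ler_wpM2l//.
    by rewrite ler_wiXn2l ?(ltW th0) ?(ltW th1)// leq_addl.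
  rewrite e; congr toT.
  rewrite mulmxBr mulmxDr mulmxA mulmxE -exprD -!scalemxAr Av scalerA.
  rewrite {1}(proj2 (hs t')) -/r.
  by apply/matrixP => i j; rewrite !mxE; ring.
(* In negative time the whole point contracts along [v], so the zero piece suffices. *)
exists 0, (((beta^-1) ^+ k.+1 * s t) *: v); split.
- have := @mem_homoclinic_pieces R n A beta v w N 0 false false N0.
  by rewrite mul0r !scale0r subr0.
- move=> i; apply: le_trans (heta i); rewrite mxE normrM -[X in X <= _]addr0.
  apply: lerD; last by rewrite mulr_ge0// exprn_ge0// ltW.
  rewrite ler_wpM2r// normrM; apply: le_trans (s_small t).
  rewrite ler_piMl// normrX normfV exprn_ile1 ?invr_ge0//.
  by rewrite invf_le1 ?ltW// (lt_trans _ b1).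
rewrite /= -[toral_map _ (iter _ _ _)]/(iter k.+1 _ _) iter_toral_map_toT add0r.
congr toT; rewrite [_ * s t]mulrC -scalerA.
have Aiv : map_mx intr (invmx M) *m v = beta^-1 *: v.
  rewrite -[v in LHS](scalerK b0) -Mv -scalemxAr mulmxA -map_mxM mulVmx// map_mx1.
  by rewrite mul1mx.
rewrite -scalemxAr; congr (_ *: _).
elim: k.+1 => [|l ih]; first by rewrite !expr0 mul1mx scale1r.
by rewrite exprSr -mulmxE -mulmxA Aiv -scalemxAr ih scalerA -exprS.
Qed.

(** * Choice of the parameters and conclusion *)

Lemma splitting_hole (R : realType) n (M : 'M[int]_n.+2) (eps : R) :
  M \in unitmx -> hyperbolic_splitting R M -> 0 < eps ->
  exists H : set (torus R n.+2),
    [/\ open H, connected H, ((1 - eps)%:E < haar R n.+2 H)%E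
      & (0%:E < hausdorff_dim (@tdist R n.+2) (survivor M H))%E].
Proof.
move=> Mu [beta [C [theta [v [w [[C0 th01 b1 bth] v0 Mv vwL hw]]]]]] eps0.
have /andP[th0 th1] := th01.
have [i vi0] : exists i, v i ord0 != 0.
  apply/existsP; apply: contraNT v0 => /existsPn h; apply/eqP/matrixP => i j.
  by rewrite (ord1 j) mxE; have := h i; rewrite negbK => /eqP.
have vi_gt0 : 0 < `|v i ord0| by rewrite normr_gt0.
pose V := \sum_j `|v j ord0|.
have leV j : `|v j ord0| <= V.
  by rewrite /V (bigD1 j)//= lerDl sumr_ge0.
have V0 : 0 < V by apply: lt_le_trans (leV i).
pose E := 2 * V + C / (1 - theta).
have E0 : 0 < E.
  by rewrite /E ltr_pwDl ?mulr_gt0// divr_ge0// subr_ge0 ltW.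
(* There are [4 * N] pieces, so the two size conditions of [connected_hole] follow from
   [16 * N * eta < min(1, eps)]. The bound 1/4 provides the ratio required by
   [cantor_separation]. *)
pose e := Num.min (Num.min 1 eps / (16 * E)) 4^-1.
have e0 : 0 < e.
  by rewrite lt_min invr_gt0 divr_gt0 ?lt_min ?ltr01 ?mulr_gt0//= ltr0n.
have [N [N0 Neven Ne]] := mul_expr_even_small th01 e0.
have N1 : 1 <= N%:R :> R by rewrite ler1n.
pose eta := E * theta ^+ N.
have eta0 : 0 < eta by rewrite mulr_gt0// exprn_gt0.
have Neta : N%:R * (16 * eta) < Num.min 1 eps.
  have : N%:R * theta ^+ N < Num.min 1 eps / (16 * E).
    by apply: lt_le_trans Ne _; rewrite ge_min lexx.
  rewrite ltr_pdivlMr ?mulr_gt0//.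
  by have -> : N%:R * theta ^+ N * (16 * E) = N%:R * (16 * eta) by rewrite /eta; ring.
have thN : theta ^+ N < 1 / 4.
  apply: le_lt_trans (lt_le_trans Ne _); last by rewrite ge_min div1r lexx orbT.
  by rewrite ler_peMl// exprn_ge0// ltW.
have lam0 : 0 < (beta ^+ N)^-1.
  by rewrite invr_gt0 exprn_even_gt0// -normr_gt0 (lt_trans _ b1)// orbT.
have lamth : (beta ^+ N)^-1 <= theta ^+ N.
  rewrite -(ger0_norm (ltW lam0)) normfV normrX -exprVn lerXn2r ?nnegrE ?invr_ge0//.
  exact: ltW.
have lam14 : 0 < (beta ^+ N)^-1 <= 1 / 4 by rewrite lam0/= (le_trans lamth (ltW thN)).
have [|s hs] := @cantor_function R (beta ^+ N)^-1; first by clear -lam14; lra.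
have sep := cantor_separation lam14 hs.
have heta j : 2 * (beta ^+ N)^-1 * `|v j ord0| + C / (1 - theta) * theta ^+ N <= eta.
  rewrite /eta /E [X in _ <= X]mulrDl lerD2r -!mulrA ler_pM2l// mulrC.
  by apply: ler_pM => //; exact: ltW.
pose F := homoclinic_pieces (map_mx intr M) beta v w N.
have sizeF : (size F)%:R = N%:R * 4 :> R.
  by rewrite /F size_allpairs size_iota natrM.
have eta4 : 4 * eta < 1.
  have : 16 * eta <= N%:R * (16 * eta) by rewrite ler_peMl// mulr_ge0// ltW.
  by move: Neta; rewrite lt_min => /andP[+ _]; lra.
have eta2 : eta < 2^-1 by clear -eta4; lra.
move: (Neta); rewrite lt_min => /andP[Neta1 Netaeps].
have NetaE : 0 < N%:R * eta by rewrite mulr_gt0// ltr0n.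
have [||H [oH cH hH avoid]] := @connected_hole R n F eta eps eta0 eta4.
- by rewrite sizeF; clear -Neta1 NetaE; lra.
- by rewrite sizeF; clear -Netaeps NetaE; lra.
exists H; split => //.
apply: (@hausdorff_dim_gt0 _ _ _ _ (fun t => toT (s t *: v)) (2^-1 * `|v i ord0|)
  (beta ^+ N)^-1).
- by rewrite mulr_gt0// invr_gt0.
- by clear -lam14; lra.
- move=> t _; apply/seteqP; split => // _ [[k _ <-]].
  have [f [u [fF hu ->]]] := orbit_near_pieces Mu N0 C0 th01 b1 Mv vwL hw hs heta t k.
  exact: avoid.
move=> J t t' ht ht' tJ.
have sE : (s t *: v) i ord0 - (s t' *: v) i ord0 = (s t - s t') * v i ord0.
  by rewrite !mxE mulrBl.
apply: (@le_trans _ _ `|(s t *: v) i ord0 - (s t' *: v) i ord0|).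
  by rewrite sE normrM mulrAC ler_wpM2r//; exact: sep.
(* In coordinate [i] the whole Cantor set has extent at most [eta < 1/2]. *)
apply: tdist_ge_coord; rewrite sE normrM.
apply: (@le_trans _ _ (2 * (beta ^+ N)^-1 * `|v i ord0|)).
  have [st _] := hs t; have [st' _] := hs t'.
  by rewrite ler_wpM2r//; exact: dist_le_bound.
apply: le_trans (ltW eta2); apply: le_trans (heta i).
by rewrite lerDl mulr_ge0 ?exprn_ge0 ?divr_ge0 ?subr_ge0// ltW.
Qed.

Theorem theorem4p15 (R : realType) (m : nat) (M : 'M[int]_m) (hm : (2 <= m)%N)
    (hM : M \in unitmx) (hP : generalized_pisot R M)
    (eps : R) (heps : 0 < eps) :
  exists H : set (torus R m),
    [/\ open H,
        connected H,
        ((1 - eps)%:E < haar R m H)%E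
      & (0%:E < hausdorff_dim (@tdist R m) (survivor M H))%E].
Proof.
case: m hm M hM hP => [|[|n]] // _ M hM hP.
(* A change of sign is absorbed by [hyperbolic_splittingN], which leaves [M] and its inverse. *)
have [splitM|splitV] : hyperbolic_splitting R M \/ hyperbolic_splitting R (invmx M).
  case: hP => /pisot_splitting h; [left|left|right|right] => //;
    exact: hyperbolic_splittingN.
- exact: splitting_hole.
- have [|H [oH cH hH dH]] := splitting_hole _ splitV heps; first by rewrite unitmx_inv.
  by rewrite survivor_invmx in dH; exists H.
Qed.
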